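(* Consider the ATO-TOS system with individual state-dependent replenishments with $I\ge3$. If its transition function $f_T$ is monotone for a partial order $\preceq$ on $\mathcal{X}$ (i.e. for all $a\in\mathcal{E}$ and all $x,y\in\mathcal{X}$, $x\preceq y$ implies $f_T(x,a)\preceq f_T(y,a)$), then $\preceq$ is the trivial order, i.e. $x\preceq y\Leftrightarrow x=y$ for all $x,y\in\mathcal{X}$.
   Context: Let $I\ge 1$ be an integer, $\mathcal{I}=\{1,\dots,I\}$, and let $C_1,\dots,C_I$ be positive integers. The state space is $\mathcal{X}=\{0,\dots,C_1\}\times\cdots\times\{0,\dots,C_I\}$. Let $e_i$ be the vector with all components $0$ except the $i$-th, equal to $1$, and $e_A=\sum_{i\in A}e_i$ for $A\subset\mathcal{I}$. Service rates: for each $i\in\mathcal{I}$, $\mu_i:\{0,\dots,C_i\}\to[0,\infty)$ with $\mu_i(0)=0$ and $\mu_i(x)>0$ for $x\ge 1$. Let $(\ell_i^{(0)},\dots,\ell_i^{(C_i)})$ be an ordering (permutation) of $\{0,\dots,C_i\}$ with $0=\mu_i(\ell_i^{(0)})\le\mu_i(\ell_i^{(1)})\le\dots\le\mu_i(\ell_i^{(C_i)})$. Events: $\mathcal{E}=\{d_A:\emptyset\ne A\subset\mathcal{I}\}\cup\{s_i^{(j)}:i\in\mathcal{I},1\le j\le C_i\}$ (all nonempty subsets $A$ are included). The transition function $f_T:\mathcal{X}\times\mathcal{E}\to\mathcal{X}$ of the ATO-TOS (assemble-to-order, total order service) system is $$f_T(x,d_A)=x+\Big(\prod_{i\in A}\mathbf{1}_{\{x_i<C_i\}}\Big)e_A,\qquad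 f_T(x,s_i^{(j)})=x-\sum_{k=j}^{C_i}\mathbf{1}_{\{x_i=\ell_i^{(k)}\}}e_i .$$ *)

(* Defs.v *)
From HB Require Import structures.
From mathcomp Require Import all_boot all_order all_fingroup all_algebra.
From mathcomp Require Import reals.
From Stdlib Require Export Relation_Definitions.

Set Implicit Arguments.
Unset Strict Implicit.
Unset Printing Implicit Defensive.

Import Order.TTheory GRing.Theory Num.Theory.

(* The item set {1, ..., I} is 'I_n with n := I, and {0, ..., C_i} is
   'I_(C i).+1, so that a state assigns to each i a level between 0 and C_i. *)
Definition state (n : nat) (C : 'I_n -> nat) : Type :=
  {dffun forall i : 'I_n, 'I_(C i).+1}.

(* [demand hA] is d_A for nonempty A; [service hj] is s_i^(j) for
   1 <= j <= C_i. *)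
Inductive event (n : nat) (C : 'I_n -> nat) : Type :=
| demand (A : {set 'I_n}) of A != set0
| service (i : 'I_n) (j : 'I_(C i).+1) of 0 < j.

Definition service_rates (R : realType) (n : nat) (C : 'I_n -> nat)
    (mu : forall i : 'I_n, 'I_(C i).+1 -> R) : Prop :=
  forall i, mu i ord0 = 0%R /\ forall x : 'I_(C i).+1, 0 < x -> (0 < mu i x)%R.

(* [l i k] is the level l_i^(k); being an ordering of {0, ..., C_i} is part of
   the type {perm 'I_(C i).+1}. *)
Definition rate_ordering (R : realType) (n : nat) (C : 'I_n -> nat)
    (mu : forall i : 'I_n, 'I_(C i).+1 -> R)
    (l : forall i : 'I_n, {perm 'I_(C i).+1}) : Prop :=
  forall i, mu i (l i ord0) = 0%R /\
    forall j k : 'I_(C i).+1, j <= k -> (mu i (l i j) <= mu i (l i k))%R.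

(* The k-th coordinate of f_T(x, a). The subtraction is the truncated one of
   nat, but never actually truncates: see [service_coord_exact]. *)
Definition fT_coord (n : nat) (C : 'I_n -> nat)
    (l : forall i : 'I_n, {perm 'I_(C i).+1})
    (x : state C) (a : event C) (k : 'I_n) : nat :=
  match a with
  | @demand _ _ A _ => x k + (\prod_(i in A) (x i < C i)) * (k \in A)
  | @service _ _ i j _ =>
      x k - (\sum_(m < (C i).+1 | j <= m) (x i == l i m)) * (k == i)
  end.

Lemma fT_coord_bound (n : nat) (C : 'I_n -> nat)
    (l : forall i : 'I_n, {perm 'I_(C i).+1})
    (x : state C) (a : event C) (k : 'I_n) :
  fT_coord l x a k < (C k).+1.
Proof.
case: a => [A _|i j _] /=; last by rewrite ltnS (leq_trans (leq_subr _ _)) // -ltnS.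
case kA: (k \in A); last by rewrite muln0 addn0.
rewrite muln1 (bigD1 k) //=.
case: (ltnP (x k) (C k)) => xk; last by rewrite mul0n addn0.
rewrite mul1n; suff: \prod_(i in A | i != k) (x i < C i) <= 1.
  by move=> h; rewrite ltnS (leq_trans (leq_add (leqnn _) h)) // addn1.
by elim/big_ind: _ => // [a b|i _]; [case: a => [|[]] //; case: b => [|[]] | case: (_ < _)].
Qed.

Definition fT (n : nat) (C : 'I_n -> nat)
    (l : forall i : 'I_n, {perm 'I_(C i).+1})
    (x : state C) (a : event C) : state C :=
  [ffun k : 'I_n => Ordinal (fT_coord_bound l x a k)].

Lemma fTE (n : nat) (C : 'I_n -> nat)
    (l : forall i : 'I_n, {perm 'I_(C i).+1})
    (x : state C) (a : event C) (k : 'I_n) :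
  fT l x a k = fT_coord l x a k :> nat.
Proof. by rewrite ffunE. Qed.

Lemma service_coord_exact (R : realType) (n : nat) (C : 'I_n -> nat)
    (mu : forall i : 'I_n, 'I_(C i).+1 -> R)
    (l : forall i : 'I_n, {perm 'I_(C i).+1}) :
  service_rates mu -> rate_ordering mu l ->
  forall (x : state C) (i : 'I_n) (j : 'I_(C i).+1) (k : 'I_n), 0 < j ->
  (\sum_(m < (C i).+1 | j <= m) (x i == l i m)) * (k == i) <= x k.
Proof.
move=> hmu hl x i j k j0; case: eqP => [->|_]; last by rewrite muln0.
rewrite muln1.
have l0 : l i ord0 = ord0.
  case: (hmu i) => _ pos; case: (hl i) => z _.
  case: (posnP (l i ord0)) => [h|/pos]; first exact/val_inj.
  by rewrite z ltxx.
pose m0 := ((l i)^-1)%g (x i).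
have E m : (x i == l i m) = (m == m0) by rewrite -(inj_eq (@perm_inj _ (l i))) permKV eq_sym.
rewrite (eq_bigr (fun m : 'I__ => (m == m0) : nat)); last by move=> m _; rewrite E.
case: (leqP j m0) => h.
  rewrite (bigD1 m0) //= eqxx big1 ?addn0; last by move=> m /andP[_ /negbTE->].
  rewrite lt0n; apply/negP => /eqP x0.
  have : m0 = ord0.
    apply: (@perm_inj _ (l i)); rewrite permKV l0; exact/val_inj.
  by move=> m00; move: h; rewrite m00 leqNgt j0.
rewrite big1 // => m jm; case: eqP => // e; move: jm; by rewrite e leqNgt h.
Qed.

(* Prop-valued relations are used so that no decidability of the order is
   assumed. *)
Definition monotone_transition (S E : Type) (f : S -> E -> S)
    (le : relation S) : Prop :=
  forall (a : E) (x y : S), le x y -> le (f x a) (f y a).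

(* Main.v *)
Require Import Defs.
From mathcomp Require Import all_boot all_order all_fingroup all_algebra.
From mathcomp Require Import reals.
From mathcomp Require Import zify.

Set Implicit Arguments.
Unset Strict Implicit.
Unset Printing Implicit Defensive.

(** Demands for single items and full services [s_i^(1)] move one coordinate by
    one in every state, stopping at the boundary. Hence a comparison [x <= y]
    with [x_i < y_i] can be transported to [z <= z + e_i] for every [z]: pushing
    coordinate [i] up to [(C_i - 1, C_i)] and back down makes the gap equal to
    one, and the other coordinates can be emptied and refilled to any common
    value. The demand for two items [i], [j] applied at levels [C_i - 1] and
    [C_i] then succeeds only in the smaller state, so an order that increases
    along [e_i] decreases along [e_j]. Three coordinates cannot have pairwise
    opposite directions. *)

Section SingleCoordinate.
Variables (n : nat) (C : 'I_n -> nat).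
Hypothesis C_gt0 : forall i, 0 < C i.
Variable l : forall i : 'I_n, {perm 'I_(C i).+1}.
Hypothesis l0 : forall i, l i ord0 = ord0.
Implicit Types (x y z w : state C) (i j k : 'I_n) (le : relation (state C)).

Lemma state_ext x y : (forall k, x k = y k :> nat) -> x = y.
Proof. by move=> e; apply/ffunP => k; apply/val_inj/e. Qed.

Lemma set1_neq0 i : [set i] != set0.
Proof. by apply/set0Pn; exists i; rewrite set11. Qed.

Definition demand1 i x : state C :=
  fT l x (demand C (set1_neq0 i)).

Definition service1 i x : state C :=
  fT l x (@service n C i (Ordinal (C_gt0 i : 1 < (C i).+1)) isT).

Lemma demand1E i x k :
  demand1 i x k = (if k == i then minn (x k).+1 (C k) else x k) :> nat.
Proof.
rewrite fTE /= big_set1 in_set1.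
case: eqP => [->|_]; last by rewrite muln0 addn0.
rewrite muln1; case: ltnP => h; first by rewrite addn1 (minn_idPl h).
by rewrite addn0; apply/eqP; rewrite eqn_leq leq_min leqnSn geq_min h orbT -ltnS ltn_ord.
Qed.

(** The rate index of a level is at least 1 unless the level is $\ell_i^{(0)} = 0$, so $s_i^{(1)}$
    serves every nonempty level. *)
Lemma service1E i x k :
  service1 i x k = (if k == i then (x k).-1 else x k) :> nat.
Proof.
rewrite fTE /=.
case: eqP => [->|_]; last by rewrite muln0 subn0.
rewrite muln1; have [m ->] : exists m, x i = l i m.
  by exists ((l i)^-1 (x i))%g; rewrite permKV.
under eq_bigr do rewrite (inj_eq perm_inj).
case: (posnP m) => [m0|m_gt0].
  have -> : m = ord0 by apply: val_inj.
  by rewrite l0.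
rewrite (bigD1 m) //= eqxx big1 ?addn0 ?subn1 // => p /andP[_ pm].
by rewrite eq_sym (negPf pm).
Qed.

Lemma iter_demand1E i m x k :
  iter m (demand1 i) x k = (if k == i then minn (x k + m) (C k) else x k) :> nat.
Proof.
elim: m => [|m IH] /=.
  by rewrite addn0; case: eqP => // _; rewrite (minn_idPl _) // -ltnS.
by rewrite demand1E IH; case: eqP => // _; lia.
Qed.

Lemma iter_service1E i m x k :
  iter m (service1 i) x k = (if k == i then x k - m else x k) :> nat.
Proof.
elim: m => [|m IH] /=; first by rewrite subn0 if_same.
by rewrite service1E IH; case: eqP => // _; rewrite subnS.
Qed.

Lemma monotone_iter le (f : state C -> state C) m x y :
  (forall x y, le x y -> le (f x) (f y)) ->
  le x y -> le (iter m f x) (iter m f y).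
Proof. by move=> hf hxy; elim: m => //= m; apply: hf. Qed.

(** The coordinates are given as a list so that they can be replaced one at a time by induction. *)
Definition override (s : seq 'I_n) z x : state C :=
  [ffun k => if k \in s then z k else x k].

Lemma overrideE s z x k : override s z x k = if k \in s then z k else x k.
Proof. by rewrite ffunE. Qed.

(** Overriding is a composition of events: for each listed [i], [C i] services empty the coordinate
    and [z i] demands refill it. *)
Lemma monotone_override le s z x y :
  monotone_transition (fT l) le ->
  le x y -> le (override s z x) (override s z y).
Proof.
move=> mono hxy; elim: s => [|i s IH].
  have E u : override [::] z u = u by apply/ffunP => k; rewrite overrideE.
  by rewrite !E.
have E u : override (i :: s) z u =
    iter (z i) (demand1 i) (iter (C i) (service1 i) (override s z u)).
  apply: state_ext => k.
  rewrite iter_demand1E iter_service1E !overrideE inE.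
  case: eqP => [->|_] //=; have := ltn_ord (z i).
  by case: ifP => _; have := ltn_ord (u i); lia.
by rewrite !E; do 2 (apply: monotone_iter; first by move=> ? ?; apply: mono).
Qed.

Definition increasing_along le i :=
  forall z w, w i = (z i).+1 :> nat -> (forall k, k != i -> w k = z k) -> le z w.

Lemma increasing_along_of_lt le x y i :
  monotone_transition (fT l) le -> le x y -> x i < y i ->
  increasing_along le i.
Proof.
move=> mono hxy lt_xy z w wz_i wz.
(* The demands bring [x i] to [C i - 1], while the larger [y i] is capped at [C i]. The services
   lower these to [z i] and [z i + 1]. All coordinates but [i] are then set to those of [z]. *)
pose g u := override (rem i (enum 'I_n)) z
  (iter ((C i).-1 - z i) (service1 i) (iter (C i - (x i).+1) (demand1 i) u)).
have mem_rest k : (k \in rem i (enum 'I_n)) = (k != i).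
  by rewrite mem_rem_uniq ?enum_uniq // !inE mem_enum andbT.
have gE u k : g u k = (if k != i then z k : nat
    else minn (u k + (C i - (x i).+1)) (C k) - ((C i).-1 - z i)) :> nat.
  rewrite overrideE mem_rest; case: eqP => //= ->.
  by rewrite iter_service1E iter_demand1E eqxx.
have := ltn_ord (w i); have := ltn_ord (y i) => yi wi.
have -> : z = g x.
  by apply: state_ext => k; rewrite gE; case: eqP => //= ->; lia.
have -> : w = g y.
  apply: state_ext => k; rewrite gE; case: eqP => [->|/eqP/wz-> //] /=; lia.
apply: monotone_override => //.
by do 2 (apply: monotone_iter; first by move=> ? ?; apply: mono).
Qed.

Lemma increasing_along_flip le i j :
  monotone_transition (fT l) le -> j != i ->
  increasing_along le i -> increasing_along (fun x y => le y x) j.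
Proof.
move=> mono ji inc.
(* Coordinate [j] is empty in both states, so only coordinate [i] decides whether the joint demand
   is accepted: it is at [x] and not at [y]. *)
pose x : state C := [ffun k => if k == i then inord (C k).-1 else ord0].
pose y : state C := [ffun k => if k == i then ord_max else ord0].
have xi : x i = (C i).-1 :> nat by rewrite ffunE eqxx inordK // ltnS leq_pred.
have yi : y i = C i :> nat by rewrite ffunE eqxx.
have xj : x j = 0 :> nat by rewrite ffunE (negPf ji).
have yj : y j = 0 :> nat by rewrite ffunE (negPf ji).
have le_xy : le x y.
  apply: inc => [|k ki]; first by rewrite xi yi prednK.
  by rewrite !ffunE (negPf ki).
have ij0 : [set i; j] != set0 by apply/set0Pn; exists i; rewrite set21.
have le_fxy := mono (demand C ij0) _ _ le_xy.
(* The images have [j]-th coordinates 1 and 0, so the comparison is a strict increase for the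
   reversed order. *)
apply: (increasing_along_of_lt _ le_fxy) => [a u v|]; first exact: mono.
rewrite !fTE /= !big_setU1 ?inE ?(eq_sym i) ?(negPf ji) //= !big_set1.
by rewrite eqxx xi yi xj yj ltnn ltn_predL !C_gt0.
Qed.

Lemma not_increasing_along le i :
  3 <= n -> Relation_Definitions.order _ le -> monotone_transition (fT l) le ->
  ~ increasing_along le i.
Proof.
move=> n_ge3 [_ _ anti] mono inc.
have fresh (A : {set 'I_n}) : #|A| <= 2 -> exists k, k \notin A.
  move=> cA; have /set0Pn[k] : ~: A != set0; last by rewrite inE; exists k.
  by rewrite -card_gt0; have := cardsC A; rewrite card_ord; lia.
have [|j] := fresh [set i]; first by rewrite cards1.
rewrite inE => ji.
have [|k] := fresh [set i; j]; first by rewrite cards2; case: eqP.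
rewrite !inE negb_or => /andP[ki kj].
have dec := increasing_along_flip mono ki inc.
have mono' : monotone_transition (fT l) (fun x y => le y x).
  by move=> a x y; apply: mono.
(* Two flips, through [j], reverse the order twice, so [le] increases along [k]; the direct flip
   [dec] makes it decrease there. *)
have inc' := increasing_along_flip mono' kj (increasing_along_flip mono ji inc).
pose x : state C := [ffun => ord0].
have x0 m : x m = 0 :> nat by rewrite ffunE.
have dk : demand1 k x k = (x k).+1 :> nat.
  by rewrite demand1E eqxx x0; apply/minn_idPl.
have dm m : m != k -> demand1 k x m = x m.
  by move=> mk; apply: val_inj; rewrite /= demand1E (negPf mk).
(* Antisymmetry would identify the empty state with its successor along [k]. *)
have /(congr1 (fun u : state C => u k : nat)) :=
  anti _ _ (inc' _ _ dk dm) (dec _ _ dk dm).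
by rewrite dk; lia.
Qed.

End SingleCoordinate.

(** Every positive level has a positive rate, so a level of rate zero must be 0. *)
Lemma rate_ordering0 (R : realType) (n : nat) (C : 'I_n -> nat)
    (mu : forall i : 'I_n, 'I_(C i).+1 -> R)
    (l : forall i : 'I_n, {perm 'I_(C i).+1}) :
  service_rates mu -> rate_ordering mu l -> forall i, l i ord0 = ord0.
Proof.
move=> hmu hl i; have [_ mu_gt0] := hmu i; have [mu_l0 _] := hl i.
case: (posnP (l i ord0)) => [l0|/mu_gt0]; first exact: val_inj.
by rewrite mu_l0 Order.POrderTheory.ltxx.
Qed.

Theorem proposition12 (R : realType) (n : nat) (hn : 3 <= n)
    (C : 'I_n -> nat) (hC : forall i : 'I_n, 0 < C i)
    (mu : forall i : 'I_n, 'I_(C i).+1 -> R) (hmu : service_rates mu)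
    (l : forall i : 'I_n, {perm 'I_(C i).+1}) (hl : rate_ordering mu l)
    (le : relation (state C)) (hle : Relation_Definitions.order (state C) le)
    (hmono : monotone_transition (fT l) le) :
  forall x y : state C, le x y <-> x = y.
Proof.
have l0 := rate_ordering0 hmu hl.
have [refl trans anti] := hle.
move=> x y; split=> [le_xy|<-]; last exact: refl.
apply: state_ext => i; case: (ltngtP (x i) (y i)) => // lt_i.
  have inc := increasing_along_of_lt hC l0 hmono le_xy lt_i.
  by case: (not_increasing_along hC l0 hn hle hmono inc).
(* If [y i < x i], the same argument applies to the converse order, in which [y] lies below [x]. *)
pose ge := fun u v => le v u.
have mono_ge : monotone_transition (fT l) ge by move=> a u v; apply: hmono.
have order_ge : Relation_Definitions.order (state C) ge.
  split=> [//|u v w uv vw|u v uv vu]; first exact: trans vw uv.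
  exact: anti.
have inc := increasing_along_of_lt hC l0 mono_ge le_xy lt_i.
by case: (not_increasing_along hC l0 hn order_ge mono_ge inc).
Qed.
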